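(* Let $(R,f,g)$ be a commutative Krasner $(m,n)$-hyperring with nonzero scalar identity $1$, let $H$ be a subhyperring of $R$, and let $P$ be a proper hyperideal of $R$ such that $H\nsubseteq P$. If $P$ is an $n$-ary $wsq$-primary hyperideal of $R$, then $H\cap P$ is an $n$-ary $wsq$-primary hyperideal of $H$.
   Context: Notation: $m,n\ge 2$; $a_i^j$ denotes the sequence $a_i,a_{i+1},\dots,a_j$ (empty if $j<i$), and $a^{(k)}$ denotes $a$ repeated $k$ times. An $m$-ary hyperoperation $f$ on $R$ assigns to every $m$-tuple a nonempty subset of $R$ (a singleton is identified with its element). For nonempty subsets, $f(A_1^m)=\bigcup\{f(a_1^m): a_i\in A_i\}$ and $g(A_1^n)=\{g(a_1^n): a_i\in A_i\}$; an element $x$ in an argument stands for $\{x\}$. A canonical $m$-ary hypergroup $(R,f)$: $f$ is associative and commutative; there is a unique $0\in R$ with $f(x,0^{(m-1)})=\{x\}$ for all $x$; each $x$ has a unique $-x$ with $0\in f(x,-x,0^{(m-2)})$; and $x\in f(x_1^m)$ implies $x_i\in f(x,-x_1,\dots,-x_{i-1},-x_{i+1},\dots,-x_m)$ for each $i$. A Krasner $(m,n)$-hyperring $(R,f,g)$: $(R,f)$ is a canonical $m$-ary hypergroup, $g:R^n\to R$ is associative ($n$-ary semigroup), $g$ is distributive over $f$ in each argument, i.e. $g(a_1^{i-1},f(x_1^m),a_{i+1}^n)=f(g(a_1^{i-1},x_1,a_{i+1}^n),\dots,g(a_1^{i-1},x_m,a_{i+1}^n))$, and $0$ is absorbing for $g$.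 Commutative means $g$ is symmetric in its arguments; a scalar identity $1$ satisfies $g(x,1^{(n-1)})=x$ for all $x$. All Krasner $(m,n)$-hyperrings considered are commutative with a nonzero scalar identity. A subhyperring of $R$ is a nonempty subset $H$ such that $(H,f,g)$ (with the restricted operations) is a Krasner $(m,n)$-hyperring. In line with the convention just stated, $H$ has a nonzero scalar identity $1_H$ of its own; it is not assumed that $1_H=1$ or that $1\in H$. A hyperideal of $R$ is a nonempty $I\subseteq R$ that is an $m$-ary subhypergroup of $(R,f)$ (closed under $f$ and under $x\mapsto -x$) with $g(a_1^{i-1},I,a_{i+1}^n)\subseteq I$ for all $a_1^n\in R$ and all $i$. A proper hyperideal $Q$ is ($n$-ary) prime if $g(a_1^n)\in Q$ with $a_1^n\in R$ implies $a_i\in Q$ for some $i$. The radical $\mathbf{r}^{(m,n)}(I)$ of a hyperideal $I$ is the intersection of all prime hyperideals containing $I$ (equal to $R$ if there are none). A proper hyperideal $P$ of a commutative Krasner $(m,n)$-hyperring $R$ with scalar identity $1$ is $n$-ary $wsq$-primary (weakly strongly quasi-primary) if for all $r_1^n\in R$, $0\ne g(r_1^n)\in P$ implies $g(r_i^{(2)},1^{(n-2)})\in P$ or $g(r_1^{i-1},1,r_{i+1}^n)\in \mathbf{r}^{(m,n)}(P)$ for some $1\le i\le n$. For $H\cap P$, everything, including the identity and the radical, is taken in $H$.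
   Formalization: A subhyperring H is required to contain the zero of R and to share its zero and negation; if H may have a different zero, H∩P can be empty and the claim fails (R = sign hyperfield × F₂, H = {1}×F₂, P = {0}). *)

(* Defs.v *)
From mathcomp Require Import all_boot all_fingroup.
From mathcomp Require Import boolp classical_sets.

Set Implicit Arguments.
Unset Strict Implicit.
Unset Printing Implicit Defensive.

Local Open Scope classical_set_scope.

(* The tuple (s_1, ..., s_k, e, ..., e) of length n: [pad n [:: x] e] is
   (x, e^(n-1)) and [pad n [:: x; y] e] is (x, y, e^(n-2)). *)
Definition pad (T : Type) (n : nat) (s : seq T) (e : T) : n.-tuple T :=
  [tuple nth e s i | i < n].

(* (a_1^{i-1}, x, a_{i+1}^n) *)
Definition upd (T : Type) (n : nat) (a : n.-tuple T) (i : 'I_n) (x : T) :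
    n.-tuple T :=
  [tuple if j == i then x else tnth a j | j < n].

Definition tuple_in (T : Type) (n : nat) (A : set T) (t : n.-tuple T) : Prop :=
  forall i, A (tnth t i).

(* Zero and negation are part of the signature, so a substructure shares them
   with the ambient structure.  The scalar identity is deliberately not part of
   it: a subhyperring may have another one. *)
Record hyperstructure (m n : nat) (T : Type) := Hyperstructure {
  hadd : m.-tuple T -> set T;
  hmul : n.-tuple T -> T;
  hzero : T;
  hopp : T -> T
}.

(* All notions below are relative to a carrier [A : set T]; they only involve
   the values of the operations on A. *)
Section Krasner.
Variables (T : Type) (m n : nat) (S : hyperstructure m n T).
Local Notation f := (hadd S).
Local Notation g := (hmul S).
Local Notation "0" := (hzero S).
Local Notation opp := (hopp S).
Implicit Types (A I P Q : set T) (e x y : T).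

Definition hadd_sets (B : 'I_m -> set T) : set T :=
  [set y | exists2 t : m.-tuple T, (forall k, B k (tnth t k)) & f t y].

(* f(a_0^{i-1}, f(a_i^{i+m-1}), a_{i+m}^{2m-2}), indices starting at 0; only
   the first 2m-1 terms of the sequence a are used. *)
Definition hadd_nested (a : nat -> T) (i : 'I_m) : set T :=
  hadd_sets (fun k : 'I_m =>
    if k < i then [set a k]
    else if i < k then [set a (k + m).-1]
    else f [tuple a (i + l) | l < m]).

Definition hmul_nested (a : nat -> T) (i : 'I_n) : T :=
  g [tuple if k < i then a k
           else if i < k then a (k + n).-1
           else g [tuple a (i + l) | l < n] | k < n].

(* In [can_rev] the element x stands at place i instead of first, which is the
   same by [can_comm]. *)
Record canonical_hypergroup A : Prop := CanonicalHypergroup {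
  can_neq0 : forall t : m.-tuple T, tuple_in A t -> f t !=set0;
  can_closed : forall t : m.-tuple T, tuple_in A t -> f t `<=` A;
  can_assoc : forall a : nat -> T, (forall k, A (a k)) ->
    forall i j : 'I_m, hadd_nested a i = hadd_nested a j;
  can_comm : forall t : m.-tuple T, tuple_in A t ->
    forall s : 'S_m, f [tuple tnth t (s i) | i < m] = f t;
  can_0_in : A 0;
  can_0 : forall x, A x -> f (pad m [:: x] 0) = [set x];
  can_0_uniq : forall e, A e ->
    (forall x, A x -> f (pad m [:: x] e) = [set x]) -> e = 0;
  can_opp_in : forall x, A x -> A (opp x);
  can_opp : forall x, A x -> f (pad m [:: x; opp x] 0) 0;
  can_opp_uniq : forall x y, A x -> A y ->
    f (pad m [:: x; y] 0) 0 -> y = opp x;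
  can_rev : forall (t : m.-tuple T) x, tuple_in A t -> A x -> f t x ->
    forall i : 'I_m, f (upd [tuple opp (tnth t j) | j < m] i x) (tnth t i)
}.

Record krasner_hyperring A : Prop := KrasnerHyperring {
  kr_can : canonical_hypergroup A;
  kr_closed : forall t : n.-tuple T, tuple_in A t -> A (g t);
  kr_assoc : forall a : nat -> T, (forall k, A (a k)) ->
    forall i j : 'I_n, hmul_nested a i = hmul_nested a j;
  kr_distr : forall (a : n.-tuple T) (x : m.-tuple T) (i : 'I_n),
    tuple_in A a -> tuple_in A x ->
    [set g (upd a i y) | y in f x]
      = f [tuple g (upd a i (tnth x j)) | j < m];
  kr_absorb : forall (a : n.-tuple T) (i : 'I_n),
    tuple_in A a -> g (upd a i 0) = 0
}.

Definition commutative_hmul A : Prop :=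
  forall t : n.-tuple T, tuple_in A t ->
  forall s : 'S_n, g [tuple tnth t (s i) | i < n] = g t.

(* For n > 2 a scalar identity need not be unique (-1 is another one in a ring
   with g(x, y, z) = xyz), so it is always passed explicitly. *)
Definition scalar_identity A e : Prop :=
  A e /\ forall x, A x -> g (pad n [:: x] e) = x.

Definition comm_unital_krasner A e : Prop :=
  [/\ krasner_hyperring A, commutative_hmul A, scalar_identity A e & e <> 0].

Definition subhyperring A e : Prop :=
  A !=set0 /\ comm_unital_krasner A e.

Record hyperideal A I : Prop := Hyperideal {
  hid_sub : I `<=` A;
  hid_neq0 : I !=set0;
  hid_hadd : forall t : m.-tuple T, tuple_in I t -> f t `<=` I;
  hid_opp : forall x, I x -> I (opp x);
  hid_hmul : forall (a : n.-tuple T) (i : 'I_n) x,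
    tuple_in A a -> I x -> I (g (upd a i x))
}.

Definition proper_hyperideal A I : Prop := hyperideal A I /\ I <> A.

Definition prime_hyperideal A Q : Prop :=
  proper_hyperideal A Q /\
  forall a : n.-tuple T, tuple_in A a -> Q (g a) -> exists i, Q (tnth a i).

Definition radical A I : set T :=
  [set x | A x /\ forall Q, prime_hyperideal A Q -> I `<=` Q -> Q x].

Definition wsq_primary A e P : Prop :=
  proper_hyperideal A P /\
  forall r : n.-tuple T, tuple_in A r -> g r <> 0 -> P (g r) ->
  exists i : 'I_n,
    P (g (pad n [:: tnth r i; tnth r i] e)) \/ radical A P (g (upd r i e)).

End Krasner.

(* Main.v *)
Require Import Defs.
From HB Require Import structures.
From mathcomp Require Import all_boot all_fingroup.
From mathcomp Require Import boolp classical_sets.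
From mathcomp Require Import zify.

(** Write [mul x y] for [g(x, y, 1, ..., 1)].  Associativity, symmetry and the
    scalar identity make [mul] a commutative monoid law with unit 1, and [g] is
    its [n]-fold product ([hmul_big]).  So [R] is governed by a binary
    multiplication that distributes over [f], and ordinary commutative ring
    arguments become available.

    Let [r] be a tuple of [H] with [g(r)] a nonzero element of [P], and let [e]
    be the identity of [H].  The hypothesis on [P] gives an index [i] such that
    [r_i * r_i] is in [P], or the product of the other entries is in the
    radical of [P].  The elements required for [H] are the same ones multiplied
    by a power of [e], hence still lie in [P], respectively in the radical of
    [P] ([hmul_in_ideal], [radical_upd]), and they lie in [H].

    What is left is that an element [z] of [H] in the radical of [P] taken in
    [R] lies in the radical of [H `&` P] taken in [H] ([radical_trace]).  Primes
    of [H] are not known to be traces of primes of [R], so the two radicals are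
    compared through powers.  Some power of [z] is in [P] ([radical_pow]):
    otherwise a hyperideal containing [P] and maximal among those that avoid
    the powers of [z] would be prime ([exists_prime_avoiding]).  Then the
    [n]-fold power, iterated often enough, takes [z] into [H `&` P]; a prime of
    [H] containing [H `&` P] therefore contains this iterate, and so [z]. *)
Local Open Scope classical_set_scope.

(** * The binary multiplication behind the n-ary one *)

Section KrasnerRing.
Set Implicit Arguments.
Unset Strict Implicit.
Unset Printing Implicit Defensive.

Variables (m n : nat) (R : Type) (S : hyperstructure m n R) (one : R).
Hypothesis hn : 2 <= n.
Hypothesis hR : comm_unital_krasner S [set: R] one.
Local Notation f := (hadd S).
Local Notation g := (hmul S).
Local Notation "0" := (hzero S).
Local Notation opp := (hopp S).

Let n_gt0 : 0 < n. Proof. exact: ltnW. Qed.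
Local Notation i0 := (Ordinal n_gt0).
Local Notation i1 := (Ordinal hn).

Let hK : krasner_hyperring S [set: R]. Proof. by case: hR. Qed.
Let hC := kr_can hK.

Definition mul (x y : R) : R := g (pad n [:: x; y] one).

Lemma hmul_perm (s : 'S_n) (t u : n.-tuple R) :
  (forall i, tnth u i = tnth t (s i)) -> g u = g t.
Proof.
case: hR => _ comm _ _ E; rewrite -(comm t _ s) //; congr g.
by apply: eq_from_tnth => i; rewrite tnth_mktuple.
Qed.

Lemma pad2_default (x y e : R) (i : 'I_n) :
  i != i0 -> i != i1 -> nth e [:: x; y] i = e.
Proof. by rewrite -!val_eqE /=; case: (val i) => [|[|k]] //=; rewrite nth_nil. Qed.

(** The position [q] is arbitrary because the tuples produced by regrouping in
    [hmul_pad_rcons] do not have their second nontrivial entry in front. *)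
Lemma hmul_two (t : n.-tuple R) (q : 'I_n) : q != i0 ->
  (forall i, i != i0 -> i != q -> tnth t i = one) ->
  g t = mul (tnth t i0) (tnth t q).
Proof.
move=> q0 E; symmetry; apply: (hmul_perm (s := tperm i1 q)) => i.
rewrite tnth_mktuple.
case: (tpermP i1 q i) => [->|iq|/eqP ni1 /eqP niq] //=.
  rewrite iq; case: (eqVneq q i1) => [->//|q1].
  by rewrite pad2_default // E // eq_sym.
case: (eqVneq i i0) => [->//|ni0].
by rewrite pad2_default // E.
Qed.

Lemma mulC : commutative mul.
Proof.
move=> x y; apply: (hmul_perm (s := tperm i0 i1)) => i; rewrite !tnth_mktuple.
case: (tpermP i0 i1 i) => [->|->|/eqP ni0 /eqP ni1] //.
by rewrite !pad2_default.
Qed.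

Lemma mul1x : left_id one mul.
Proof.
case: hR => _ _ [_ id1] _ x; rewrite mulC -[RHS]id1 //; congr g.
by apply: eq_mktuple => i; case: (val i) => [|[|k]] //=; rewrite nth_nil.
Qed.

(** The one use of [n]-ary associativity: in the sequence
    [s, c, 1, ..., 1, x, 1, ..., 1] with [x] at index [n], grouping the first [n]
    terms gives the left-hand side, and grouping the [n] terms from [c] on gives
    the right-hand side.  For [s] of size 1 this is associativity of [mul]; for
    [c = 1] it says that appending an entry multiplies by that entry. *)
Lemma hmul_pad_rcons (s : seq R) (c x : R) : 0 < size s < n ->
  mul (g (pad n (rcons s c) one)) x = g (pad n (rcons s (mul c x)) one).
Proof.
move=> /andP[s0 sn].
pose a k := if k == n then x else nth one (rcons s c) k.
transitivity (hmul_nested S a i0).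
  rewrite /mul /hmul_nested; congr g; apply: eq_mktuple => i /=.
  case: (val i) => [|[|k]] /=.
  - congr g; apply: eq_mktuple => l /=; rewrite /a add0n.
    by case: eqP => // ln; move: (ltn_ord l); rewrite ln ltnn.
  - by rewrite /a; case: eqP => // ?; lia.
  - rewrite nth_nil /a; case: eqP => [?|_]; first lia.
    by rewrite nth_default // size_rcons; lia.
rewrite (kr_assoc hK _ i0 (Ordinal sn)) // /hmul_nested.
congr g; apply: eq_mktuple => i /=; rewrite nth_rcons.
case: ltngtP => [ilt|igt|_].
- rewrite /a nth_rcons ilt; case: eqP => // ?; lia.
- rewrite /a nth_default ?size_rcons; last lia.
  case: eqP => // ?; lia.
(* The inner product is g(c, 1, ..., 1, x, 1, ..., 1). *)
have qn : n - size s < n by lia.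
rewrite (hmul_two (q := Ordinal qn)) ?tnth_mktuple /=.
- rewrite addn0 subnKC 1?ltnW // /a eqxx nth_rcons ltnn eqxx.
  by case: eqP => // ?; lia.
- by rewrite -val_eqE /=; lia.
- move=> l; rewrite -!val_eqE tnth_mktuple /= => l0 lq.
  rewrite /a nth_default ?size_rcons; last lia.
  by case: eqP => // ?; lia.
Qed.

Lemma mulA : associative mul.
Proof. by move=> x y z; symmetry; apply: (@hmul_pad_rcons [:: x] y z). Qed.

HB.instance Definition _ := Monoid.isComLaw.Build R one mul mulA mulC mul1x.

Lemma hmul_pad (s : seq R) : size s <= n ->
  g (pad n s one) = \big[mul/one]_(x <- s) x.
Proof.
case: hR => _ _ [_ id1] _.
elim/last_ind: s => [_|s x IH].
  rewrite big_nil -[RHS]id1 //; congr g; apply: eq_mktuple => i.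
  by case: (val i) => [|k]//=; rewrite nth_nil.
rewrite size_rcons => sn; rewrite big_rcons /=.
case: (posnP (size s)) => [/size0nil ->|s0]; first by rewrite big_nil mul1x id1.
rewrite -IH 1?ltnW //.
rewrite -[x in LHS]mul1x -hmul_pad_rcons ?s0 //.
congr mul; congr g; apply: eq_mktuple => i.
by rewrite nth_rcons; case: ltngtP => // *; rewrite nth_default //; lia.
Qed.

Lemma hmul_big (t : n.-tuple R) : g t = \big[mul/one]_(i < n) tnth t i.
Proof.
rewrite -(big_tuple _ _ t predT id) -hmul_pad ?size_tuple //.
by congr g; apply: eq_from_tnth => i; rewrite tnth_mktuple -tnth_nth.
Qed.

Lemma hmul_upd (t : n.-tuple R) (i : 'I_n) (x : R) :
  g (upd t i x) = mul x (\big[mul/one]_(j < n | j != i) tnth t j).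
Proof.
rewrite hmul_big (bigD1 i) //= tnth_mktuple eqxx; congr mul.
by apply: eq_bigr => j /negbTE ji; rewrite tnth_mktuple ji.
Qed.

(** Presents [mul x y] as a substitution in a fixed tuple, the form in which
    distributivity, absorption and the ideal property are stated. *)
Lemma mulE (x y : R) : mul x y = g (upd (pad n [:: y; y] one) i0 x).
Proof.
congr g; apply: eq_mktuple => i; rewrite tnth_mktuple -val_eqE /=.
by case: (val i) => [|[|k]].
Qed.

Lemma mul_hadd (t : m.-tuple R) (y : R) :
  [set mul x y | x in f t] = f [tuple mul (tnth t j) y | j < m].
Proof.
have -> : [tuple mul (tnth t j) y | j < m] =
    [tuple g (upd (pad n [:: y; y] one) i0 (tnth t j)) | j < m].
  by apply: eq_mktuple => j; rewrite mulE.
rewrite -(kr_distr hK) //.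
by apply: eq_imagel => x _; rewrite mulE.
Qed.

Lemma mul0x (y : R) : mul 0 y = 0.
Proof. by rewrite mulE (kr_absorb hK). Qed.

(** Multiplying [0 \in f(x, -x, 0, ..., 0)] by [y] shows that [(-x) y] is an
    opposite of [x y], and opposites are unique. *)
Lemma mulNx (x y : R) : mul (opp x) y = opp (mul x y).
Proof.
apply: (can_opp_uniq hC) => //.
have -> : pad m [:: mul x y; mul (opp x) y] 0 =
    [tuple mul (tnth (pad m [:: x; opp x] 0) j) y | j < m].
  apply: eq_mktuple => j; rewrite tnth_mktuple.
  by case: (val j) => [|[|k]] //=; rewrite nth_nil mul0x.
rewrite -mul_hadd; exists 0; last exact: mul0x.
exact: (can_opp hC).
Qed.

(** * Hyperideals *)

Section Ideal.
Variable I : set R.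
Hypothesis hI : hyperideal S [set: R] I.

Lemma ideal_mulr (x y : R) : I x -> I (mul x y).
Proof. by move=> Ix; rewrite mulE; apply: (hid_hmul hI). Qed.

Lemma ideal_mull (x y : R) : I y -> I (mul x y).
Proof. by rewrite mulC; apply: ideal_mulr. Qed.

(** The colon hyperideal [(I : y)].  Maximality arguments below enlarge a
    hyperideal by taking colons: unlike the hyperideal generated by [I] and an
    element, a colon needs no description of sums of elements. *)
Lemma hyperideal_colon (y : R) : hyperideal S [set: R] [set x | I (mul x y)].
Proof.
split => //.
- by have [x Ix] := hid_neq0 hI; exists x; apply: ideal_mulr.
- move=> t It x ftx; apply: (hid_hadd hI (t := [tuple mul (tnth t j) y | j < m])).
    by move=> j; rewrite tnth_mktuple; apply: It.
  by rewrite -mul_hadd; exists x.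
- by move=> x Ix /=; rewrite mulNx; apply: (hid_opp hI).
- by move=> a i x _ Ix /=; rewrite hmul_upd Monoid.mulmAC; apply: ideal_mulr.
Qed.

Lemma hmul_in_ideal (t : n.-tuple R) (i j : 'I_n) : i != j ->
  I (mul (tnth t i) (tnth t j)) -> I (g t).
Proof.
move=> ij Iij; rewrite hmul_big (bigD1 i) //= (bigD1 j) 1?eq_sym //= mulA.
exact: ideal_mulr.
Qed.

End Ideal.

Lemma hyperideal_trace (H P : set R) : krasner_hyperring S H ->
  hyperideal S [set: R] P -> hyperideal S H (H `&` P).
Proof.
move=> hH hP; have hHC := kr_can hH; split.
- exact: subIsetl.
- exists 0; split; first exact: (can_0_in hHC).
  by have [x Px] := hid_neq0 hP; rewrite -(mul0x x); apply: ideal_mull.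
- move=> t HPt x ftx; split.
    by apply: (can_closed hHC _ ftx) => i; case: (HPt i).
  by apply: (hid_hadd hP _ ftx) => i; case: (HPt i).
- by move=> x [Hx Px]; split; [apply: (can_opp_in hHC) | apply: (hid_opp hP)].
- move=> a i x Ha [Hx Px]; split; last exact: (hid_hmul hP).
  by apply: (kr_closed hH) => j; rewrite tnth_mktuple; case: ifP.
Qed.

(** * Prime hyperideals and the radical *)

(** Since tuples are finite, a tuple of elements of the union of a chain lies in
    one member of it.  Starting from a prescribed member [X0] covers empty tuples
    and keeps the chosen member above [X0]. *)
Lemma chain_tuple (k : nat) (F : set (set R)) (X0 : set R) (t : k.-tuple R) :
  total_on F subset -> F X0 -> tuple_in (\bigcup_(X in F) X) t ->
  exists2 X, F X & X0 `<=` X /\ tuple_in X t.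
Proof.
move=> Ftot FX0 Ft.
suff /(_ k)[X FX [X0X Xt]] : forall j, exists2 X, F X &
    X0 `<=` X /\ forall i : 'I_k, i < j -> X (tnth t i).
  by exists X => //; split => // i; apply: Xt.
elim=> [|j [X FX [X0X Xt]]]; first by exists X0 => //; split.
have [jk|kj] := ltnP j k; last first.
  exists X => //; split => // i _; apply: Xt; exact: leq_trans (ltn_ord i) kj.
have [Y FY Yt] := Ft (Ordinal jk).
have [XY|YX] := Ftot X Y FX FY.
- exists Y => //; split; first exact: subset_trans XY.
  move=> i; rewrite ltnS leq_eqVlt => /orP[/eqP ij|ij].
    by rewrite (_ : i = Ordinal jk) //; apply: val_inj.
  by apply: XY; apply: Xt.
- exists X => //; split => //.
  move=> i; rewrite ltnS leq_eqVlt => /orP[/eqP ij|ij]; last exact: Xt.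
  by rewrite (_ : i = Ordinal jk); [apply: YX | apply: val_inj].
Qed.

(** Krull's theorem on ideals disjoint from a multiplicative set [C].  Let [M] be
    maximal among the hyperideals that contain [P] and avoid [C].  If [x y] is in
    [M] but neither [x] nor [y] is, then [(M : y)] strictly contains [M], so
    [c y] is in [M] for some [c] in [C]; then [(M : c)] contains [y], so [d c] is
    in [M] for some [d] in [C], although [d c] is in [C]. *)
Lemma exists_prime_avoiding (P C : set R) :
  hyperideal S [set: R] P -> C one -> (forall x y, C x -> C y -> C (mul x y)) ->
  P `&` C = set0 ->
  exists Q, [/\ prime_hyperideal S [set: R] Q, P `<=` Q & Q `&` C = set0].
Proof.
move=> hP C1 CM PC.
pose good X := [/\ hyperideal S [set: R] X, P `<=` X & X `&` C = set0].
have goodP : good P by split.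
have [p Pp] := hid_neq0 hP.
(* The empty set is added because Zorn's lemma also asks for the union of the
   empty chain. *)
have [|M [[M0|gM] Mmax]] := @Zorn_bigcup R (fun X => X = set0 \/ good X).
- move=> F Fgood Ftot.
  have [[X0 [FX0 gX0]]|nX] := pselect (exists X, F X /\ good X); last first.
    left; rewrite -subset0 => x [X FX Xx].
    by have [X_0|gX] := Fgood X FX; [rewrite X_0 in Xx | case: nX; exists X].
  have big t : tuple_in (\bigcup_(X in F) X) t ->
      exists2 X, F X & good X /\ @tuple_in R m X t.
    move=> Ft; have [X FX [X0X Xt]] := @chain_tuple _ F X0 t Ftot FX0 Ft.
    exists X => //; split => //.
    have [X_0|//] := Fgood X FX.
    by case: gX0 => _ PX0 _; have := X0X p (PX0 p Pp); rewrite X_0.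
  have goodx X x : F X -> X x -> good X.
    by move=> FX Xx; have [X_0|//] := Fgood X FX; rewrite X_0 in Xx.
  case: (gX0) => hX0 PX0 _.
  right; split; last 1 first.
  + rewrite -subset0 => x [[X FX Xx] Cx].
    by case: (goodx X x FX Xx) => _ _ <-.
  + split => //.
    * by have [x X0x] := hid_neq0 hX0; exists x, X0.
    * move=> t /big[X FX [[hX _ _] Xt]] x ftx.
      by exists X => //; apply: (hid_hadd hX Xt).
    * move=> x [X FX Xx]; exists X => //.
      by case: (goodx X x FX Xx) => hX _ _; apply: (hid_opp hX).
    * move=> a i x _ [X FX Xx]; exists X => //.
      by case: (goodx X x FX Xx) => hX _ _; apply: (hid_hmul hX).
  + by move=> x Px; exists X0 => //; apply: PX0.
- case: (Mmax P); last by right.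
  by rewrite M0; split => // /(_ p Pp).
case: gM => hM PM MC.
have enlarge X x : hyperideal S [set: R] X -> M `<=` X -> X x -> ~ M x ->
    exists2 c, C c & X c.
  move=> hX MX Xx nMx; apply: contrapT => nC.
  apply: (Mmax X); first by split => // XM; apply: nMx; apply: XM.
  right; split => //; first exact: subset_trans MX.
  by rewrite -subset0 => c [Xc Cc]; case: nC; exists c.
have M_prime x y : M (mul x y) -> M x \/ M y.
  move=> Mxy; apply: contrapT => /not_orP[nMx nMy].
  have [c Cc Mcy] := enlarge _ x (hyperideal_colon hM y)
    (fun z Mz => ideal_mulr hM y Mz) Mxy nMx.
  have Myc : M (mul y c) by rewrite mulC.
  have [d Cd Mdc] := enlarge _ y (hyperideal_colon hM c)
    (fun z Mz => ideal_mulr hM c Mz) Myc nMy.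
  by rewrite -[False]/(set0 (mul d c)) -MC; split => //; apply: CM.
have nM1 : ~ M one by move=> M1; rewrite -[False]/(set0 one) -MC.
exists M; split => //; split.
  by split => // MT; apply: nM1; rewrite MT.
move=> a _; rewrite hmul_big => Ma; apply: contrapT => /forallNP nMa.
elim/big_ind: _ Ma => // [x y nMx nMy|i _]; last exact: nMa.
by case/M_prime.
Qed.

Definition pow (x : R) (k : nat) : R := iter k (mul x) one.

Lemma powD (x : R) (k l : nat) : pow x (k + l) = mul (pow x k) (pow x l).
Proof. by elim: k => [|k IH]; rewrite ?mul1x // addSn /= IH mulA. Qed.

Lemma powM (x : R) (k l : nat) : pow x (k * l) = pow (pow x k) l.
Proof. by elim: l => [|l IH]; rewrite ?muln0 // mulnS powD IH. Qed.

Lemma hmul_const (x : R) : g [tuple x | _ < n] = pow x n.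
Proof.
rewrite hmul_big (eq_bigr (fun=> x)) ?big_const_ord //.
by move=> i _; rewrite tnth_mktuple.
Qed.

Lemma radical_pow (P : set R) (x : R) : hyperideal S [set: R] P ->
  radical S [set: R] P x -> exists k, P (pow x k).
Proof.
move=> hP [_ radx]; apply: contrapT => /forallNP nPx.
have [|||Q [primeQ PQ QC]] := @exists_prime_avoiding P (range (pow x)) hP.
- by exists 0%N.
- by move=> _ _ [k _ <-] [l _ <-]; exists (k + l)%N; rewrite ?powD.
- by rewrite -subset0 => y [Py [k _ xk]]; apply: (nPx k); rewrite xk.
rewrite -[False]/(set0 x) -QC; split; first exact: radx.
by exists 1%N => //; rewrite /pow /= mulC mul1x.
Qed.

(** Descends along the exponent: if [z^(k+2)] is in [P], then [(z^n)^(k+1)] is in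
    [P] as [n (k+1) >= k+2], and a prime of [H] that contains
    [z^n = g(z, ..., z)] contains [z]. *)
Lemma radical_trace (H P : set R) : hyperideal S [set: R] P ->
  (forall t : n.-tuple R, tuple_in H t -> H (g t)) ->
  H `&` radical S [set: R] P `<=` radical S H (H `&` P).
Proof.
move=> hP Hg z [Hz /(radical_pow hP)[k]]; split => // Q [_ Qprime] HPQ.
elim: k z Hz p => [|[|k] IH] z Hz Pz.
- apply: HPQ; split => //; rewrite -[z]mul1x; exact: ideal_mulr.
- by apply: HPQ; split => //; rewrite -[z]mul1x mulC.
have Hcst : tuple_in H [tuple z | _ < n] by move=> i; rewrite tnth_mktuple.
suff /Qprime[//|i] : Q (g [tuple z | _ < n]) by rewrite tnth_mktuple.
apply: IH; first exact: Hg.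
rewrite hmul_const -powM.
have -> : (n * k.+1 = k.+2 + (n * k.+1 - k.+2))%N by nia.
by rewrite powD; apply: ideal_mulr.
Qed.

(** The two products differ by the factor [e]; each prime in the definition of
    the radical absorbs it. *)
Lemma radical_upd (P : set R) (t : n.-tuple R) (i : 'I_n) (e : R) :
  radical S [set: R] P (g (upd t i one)) -> radical S [set: R] P (g (upd t i e)).
Proof.
case=> _ radP; split => // Q primeQ PQ; case: (primeQ) => -[hQ _] _.
rewrite hmul_upd -[\big[_/_]_(_ < _ | _) _]mul1x -hmul_upd.
by apply: ideal_mull => //; apply: radP.
Qed.

End KrasnerRing.

Theorem theorem4p13 (m n : nat) (hm : 2 <= m) (hn : 2 <= n)
  (R : Type) (S : hyperstructure m n R) (one : R)
  (hR : comm_unital_krasner S [set: R] one)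
  (H : set R) (oneH : R) (hH : subhyperring S H oneH)
  (P : set R) (hP : proper_hyperideal S [set: R] P)
  (hHP : ~ (H `<=` P)) :
  wsq_primary S [set: R] one P -> wsq_primary S H oneH (H `&` P).
Proof.
move=> [_ wsqP]; case: hP => hP _; case: hH => _ [hHK _ [He _] _]; split.
  split; first exact: (hyperideal_trace hn hR hHK hP).
  by move=> HPH; apply: hHP; rewrite -HPH; apply: subIsetr.
move=> r Hr gr0 [_ Pgr].
have [//|i [Pi|radi]] := wsqP r _ gr0 Pgr; exists i.
- (* r_i and r_i occupy the first two places of the padded tuple. *)
  left; split.
    apply: (kr_closed hHK) => j; rewrite tnth_mktuple.
    by case: (val j) => [|[|k]] //=; rewrite nth_nil.
  apply: (hmul_in_ideal hn hR hP (i := Ordinal (ltnW hn))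
    (j := Ordinal hn)) => //.
  by rewrite !tnth_mktuple.
- right; apply: (radical_trace hn hR hP); first exact: (kr_closed hHK).
  split; last exact: (radical_upd hn hR).
  by apply: (kr_closed hHK) => j; rewrite tnth_mktuple; case: ifP.
Qed.
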